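(* Let $n,m\ge 1$ and $\mathfrak g=\mathfrak{gl}(n,m)$. The ring $J(\mathfrak g)$ is a direct sum $$J(\mathfrak g)=\bigoplus_{a,b\in\mathbb C/\mathbb Z}J(\mathfrak g)_{a,b},$$ where $$J(\mathfrak g)_{a,b}=(x_1\cdots x_n)^a(y_1\cdots y_m)^b\prod_{i,p}(1-x_i/y_p)\ \mathbb Z[x_1^{\pm1},\dots,x_n^{\pm1},y_1^{\pm1},\dots,y_m^{\pm1}]^{S_n\times S_m}$$ if $a+b\notin\mathbb Z$; $$J(\mathfrak g)_{a,b}=(x_1\cdots x_n)^a(y_1\cdots y_m)^{-a}J(\mathfrak g)_{0,0}$$ if $a+b\in\mathbb Z$, $a\notin\mathbb Z$; and $$J(\mathfrak g)_{0,0}=\Big\{f\in\mathbb Z[x_1^{\pm1},\dots,x_n^{\pm1},y_1^{\pm1},\dots,y_m^{\pm1}]^{S_n\times S_m}\ \Big|\ y_p\frac{\partial f}{\partial y_p}+x_i\frac{\partial f}{\partial x_i}\in(y_p-x_i)\ \text{for all } i,p\Big\}.$$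
   Context: Let $\varepsilon_1,\dots,\varepsilon_n,\delta_1,\dots,\delta_m$ be the basis of $\mathfrak h^*$ ($\mathfrak h$ the diagonal Cartan subalgebra of $\mathfrak{gl}(n,m)$) given by the weights of the standard representation. Weight group: $$P_0=\Big\{\sum_{i=1}^n\lambda_i\varepsilon_i+\sum_{p=1}^m\mu_p\delta_p:\ \lambda_i,\mu_p\in\mathbb C,\ \lambda_i-\lambda_j\in\mathbb Z,\ \mu_p-\mu_q\in\mathbb Z\Big\}.$$ $\mathbb Z[P_0]$ is the group ring with basis $e^\lambda$; $x_i=e^{\varepsilon_i}$, $y_p=e^{\delta_p}$, and for $a\in\mathbb C$, $(x_1\cdots x_n)^a=e^{a(\varepsilon_1+\dots+\varepsilon_n)}$, $(y_1\cdots y_m)^a=e^{a(\delta_1+\dots+\delta_m)}$. $W_0=S_n\times S_m$ permutes the $\varepsilon_i$ and the $\delta_p$ separately. The operators $x_i\partial/\partial x_i$ and $y_p\partial/\partial y_p$ multiply $e^{\sum\lambda_i\varepsilon_i+\sum\mu_p\delta_p}$ by $\lambda_i$ and $\mu_p$ respectively. By definition $$J(\mathfrak g)=\Big\{f\in\mathbb Z[P_0]^{W_0}\ \Big|\ y_p\frac{\partial f}{\partial y_p}+x_i\frac{\partial f}{\partial x_i}\in(y_p-x_i),\ p=1,\dots,m,\ i=1,\dots,n\Big\},$$ where $(y_p-x_i)$ is the principal ideal generated by $y_p-x_i$ in $\mathbb C[P_0]$ (for $J(\mathfrak g)_{0,0}$, equivalently, in the Laurent polynomial ring). For classes $a,b\in\mathbb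 C/\mathbb Z$ any representatives may be used in the formulas (with the representative $b=-a$ when $a+b\in\mathbb Z$). *)

(* Defs.v *)
From HB Require Import structures.
From mathcomp Require Import all_boot all_order all_algebra all_fingroup.
From mathcomp Require Import finmap boolp classical_sets reals complex.
From mathcomp.multinomials Require Import monalg.

Set Implicit Arguments.
Unset Strict Implicit.
Unset Printing Implicit Defensive.

Import GRing.Theory Num.Theory.
Local Open Scope ring_scope.

(* The ring structure of [{malg A[P]}] requires a monoid [P] without nontrivial
   units.  [group_ring A P] is the same additive group for an additive group
   [P], with the convolution product, so that << k >> plays the role of e^k and
   e^k * e^l = e^(k + l). *)
Definition group_ring (A : comNzRingType) (P : zmodType) := {malg A[P]}.

HB.instance Definition _ A P := GRing.Lmodule.on (@group_ring A P).

Section GroupRing.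
Variables (A : comNzRingType) (P : zmodType).
Local Notation AP := (group_ring A P).
Implicit Types (f g : AP) (k : P).

Definition gr_one : AP := << 1 *g 0 >>.

Definition gr_mul f g : AP :=
  \sum_(k <- msupp f) \sum_(l <- msupp g) << f@_k * g@_l *g (k + l) >>.

Lemma gr_mulw (d1 d2 : {fset P}) f g :
  (msupp f `<=` d1)%fset -> (msupp g `<=` d2)%fset ->
  gr_mul f g = \sum_(k <- d1) \sum_(l <- d2) << f@_k * g@_l *g (k + l) >>.
Proof.
move=> le_d1 le_d2; rewrite /gr_mul (big_fset_incl _ le_d1) /=.
  apply/eq_bigr=> k1 _; apply/big_fset_incl => // k _ /mcoeff_outdom ->.
  by rewrite mulr0 monalgU0.
move=> k _ /mcoeff_outdom g1k.
by rewrite big1 => // k' _; rewrite g1k mul0r monalgU0.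
Qed.

Lemma gr_mulC : commutative gr_mul.
Proof.
move=> f g; rewrite /gr_mul exchange_big /=; apply: eq_bigr => l _.
by apply: eq_bigr => k _; rewrite mulrC addrC.
Qed.

Lemma gr_mulDl : left_distributive gr_mul +%R.
Proof.
move=> f1 f2 g.
rewrite (gr_mulw (msuppD_le f1 f2) (fsubset_refl _)).
rewrite (gr_mulw (fsubsetUl _ (msupp f2)) (fsubset_refl (msupp g))).
rewrite (gr_mulw (fsubsetUr (msupp f1) _) (fsubset_refl (msupp g))).
rewrite -big_split; apply: eq_bigr => k _; rewrite -big_split.
by apply: eq_bigr => l _; rewrite mcoeffD mulrDl monalgUD.
Qed.

Lemma gr_mulDr : right_distributive gr_mul +%R.
Proof. by move=> f g1 g2; rewrite !(gr_mulC f) gr_mulDl. Qed.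

Lemma gr_mul0l g : gr_mul 0 g = 0.
Proof. by rewrite /gr_mul msupp0 big_seq_fset0. Qed.

Lemma gr_mul0r g : gr_mul g 0 = 0.
Proof. by rewrite gr_mulC gr_mul0l. Qed.

Lemma gr_mulUU c d k l : gr_mul << c *g k >> << d *g l >> = << c * d *g (k + l) >>.
Proof.
by rewrite (gr_mulw msuppU_le msuppU_le) !big_seq_fset1 !mcoeffUU.
Qed.

Lemma gr_mul1l : left_id gr_one gr_mul.
Proof.
move=> g; rewrite (gr_mulw msuppU_le (fsubset_refl _)) big_seq_fset1.
rewrite [RHS]monalgE; apply: eq_bigr => k _.
by rewrite mcoeffUU mul1r add0r.
Qed.

Lemma gr_mul_suml (I : Type) (s : seq I) (F : I -> AP) g :
  gr_mul (\sum_(i <- s) F i) g = \sum_(i <- s) gr_mul (F i) g.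
Proof.
by rewrite (big_morph (gr_mul^~ g) (fun _ _ => gr_mulDl _ _ _) (gr_mul0l g)).
Qed.

Lemma gr_mul_sumr (I : Type) (s : seq I) (F : I -> AP) g :
  gr_mul g (\sum_(i <- s) F i) = \sum_(i <- s) gr_mul g (F i).
Proof.
by rewrite (big_morph (gr_mul g) (fun _ _ => gr_mulDr _ _ _) (gr_mul0r g)).
Qed.

Lemma gr_mulA : associative gr_mul.
Proof.
have:= gr_mulUU; have:= gr_mul_sumr; have:= gr_mul_suml.
move: gr_mul => mul suml sumr mulUU f g h.
rewrite (monalgE f) (monalgE g) (monalgE h).
rewrite !suml; apply: eq_bigr => k _.
rewrite [LHS]sumr [in RHS](sumr _ (msupp g)) suml; apply: eq_bigr => l _.
rewrite !sumr; apply: eq_bigr => j _.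
by rewrite !mulUU mulrA addrA.
Qed.

Lemma gr_one_neq0 : gr_one != 0.
Proof. by rewrite monalgU_eq0 oner_eq0. Qed.

HB.instance Definition _ := GRing.Zmodule_isComNzRing.Build AP
  gr_mulA gr_mulC gr_mul1l gr_mulDl gr_one_neq0.

End GroupRing.

Definition is_direct_sum (M : zmodType) (I : choiceType)
    (J : set M) (F : I -> set M) : Prop :=
  [/\ forall i, [/\ F i 0, forall u v, F i u -> F i v -> F i (u - v)
                  & (F i `<=` J)%classic]
    & forall f, J f -> exists! g : {fsfun I -> M with 0},
        (forall i, F i (g i)) /\ f = \sum_(i <- finsupp g) g i].

Section ComplexModZ.
Variable R : realType.

Definition Cint : {pred R[i]} := fun z => `[< exists k : int, z = k%:~R >].

Lemma Cint_zmod_closed : zmod_closed Cint.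
Proof.
split=> [|x y /asboolP[k ->] /asboolP[l ->]]; apply/asboolP; first by exists 0.
by exists (k - l); rewrite rmorphB.
Qed.

HB.instance Definition _ := GRing.isZmodClosed.Build R[i] Cint Cint_zmod_closed.

Definition CmodZ := {ideal_quot Cint}.

HB.instance Definition _ := GRing.Zmodule.on CmodZ.
HB.instance Definition _ := EqQuotient.on CmodZ.

End ComplexModZ.

Section Weights.
Variables (R : realType) (n m : nat).
Local Notation C := R[i].

(* (lambda, mu) stands for sum_i lambda_i eps_i + sum_p mu_p delta_p *)
Definition hdual := ({ffun 'I_n -> C} * {ffun 'I_m -> C})%type.
HB.instance Definition _ := GRing.Zmodule.on hdual.

Definition inP0 : {pred hdual} := fun w =>
  [forall i, forall j, w.1 i - w.1 j \in @Cint R] &&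
  [forall p, forall q, w.2 p - w.2 q \in @Cint R].

Lemma inP0P (w : hdual) :
  reflect ((forall i j, w.1 i - w.1 j \in @Cint R) /\
           (forall p q, w.2 p - w.2 q \in @Cint R)) (w \in inP0).
Proof.
apply: (iffP andP) => -[H1 H2]; split.
- by move=> i j; move/forallP/(_ i)/forallP/(_ j): H1.
- by move=> p q; move/forallP/(_ p)/forallP/(_ q): H2.
- by apply/forallP=> i; apply/forallP=> j.
- by apply/forallP=> p; apply/forallP=> q.
Qed.

Lemma inP0_zmod_closed : zmod_closed inP0.
Proof.
split=> [|u v /inP0P[u1 u2] /inP0P[v1 v2]]; apply/inP0P; split=> i j.
- by rewrite !ffunE subrr rpred0.
- by rewrite !ffunE subrr rpred0.
- by rewrite !ffunE opprD addrACA -opprD rpredB.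
- by rewrite !ffunE opprD addrACA -opprD rpredB.
Qed.

HB.instance Definition _ := GRing.isZmodClosed.Build hdual inP0 inP0_zmod_closed.

Record P0 := MkP0 { P0val :> hdual; P0valP : P0val \in inP0 }.

HB.instance Definition _ := [isSub for P0val].
HB.instance Definition _ := [Choice of P0 by <:].
HB.instance Definition _ := [SubChoice_isSubZmodule of P0 by <:].

Fact eps_subproof i :
  (([ffun j => (j == i)%:R], [ffun=> 0]) : hdual) \in inP0.
Proof.
by apply/inP0P; split=> j k; rewrite !ffunE ?subrr ?rpred0 // rpredB //;
  apply/asboolP; eexists (Posz _).
Qed.
Definition eps i : P0 := MkP0 (eps_subproof i).

Fact del_subproof p :
  (([ffun=> 0], [ffun q => (q == p)%:R]) : hdual) \in inP0.
Proof.
by apply/inP0P; split=> j k; rewrite !ffunE ?subrr ?rpred0 // rpredB //;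
  apply/asboolP; eexists (Posz _).
Qed.
Definition del p : P0 := MkP0 (del_subproof p).

(* a (eps_1 + ... + eps_n) + b (delta_1 + ... + delta_m) *)
Fact diag_weight_subproof (a b : C) :
  (([ffun=> a], [ffun=> b]) : hdual) \in inP0.
Proof. by apply/inP0P; split=> j k; rewrite !ffunE subrr rpred0. Qed.
Definition diag_weight a b : P0 := MkP0 (diag_weight_subproof a b).

(* s sends eps_i to eps_(s i), and t sends delta_p to delta_(t p) *)
Fact W0_act_subproof (s : 'S_n) (t : 'S_m) (w : P0) :
  (([ffun i => (P0val w).1 ((s^-1)%g i)],
    [ffun p => (P0val w).2 ((t^-1)%g p)]) : hdual) \in inP0.
Proof.
have /inP0P[w1 w2] := P0valP w.
by apply/inP0P; split=> j k; rewrite !ffunE.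
Qed.
Definition W0_act s t w : P0 := MkP0 (W0_act_subproof s t w).

Section Coefficients.
Variable A : comNzRingType.
Local Notation AP0 := (group_ring A P0).

Definition expw (w : P0) : AP0 := << w >>.

Definition xvar i : AP0 := expw (eps i).
Definition yvar p : AP0 := expw (del p).

(* (x_1 ... x_n)^a *)
Definition xpow (a : C) : AP0 := expw (diag_weight a 0).
(* (y_1 ... y_m)^b *)
Definition ypow (b : C) : AP0 := expw (diag_weight 0 b).

Definition W0_actr s t (f : AP0) : AP0 :=
  \sum_(w <- msupp f) << f@_w *g W0_act s t w >>.

Definition W0_invariant (f : AP0) : Prop := forall s t, W0_actr s t f = f.

(* A[x_1^{+-1}, ..., x_n^{+-1}, y_1^{+-1}, ..., y_m^{+-1}] inside A[P_0] *)
Definition Laurent (f : AP0) : Prop := forall w : P0, w \in msupp f ->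
  (forall i, (P0val w).1 i \in @Cint R) /\ (forall p, (P0val w).2 p \in @Cint R).

End Coefficients.

Local Notation ZP0 := (group_ring int P0).
Local Notation CP0 := (group_ring C P0).

Definition toCP0 (f : ZP0) : CP0 := \sum_(w <- msupp f) << (f@_w)%:~R *g w >>.

(* x_i d/dx_i, extended C-linearly from the weights *)
Definition xdx i (f : CP0) : CP0 :=
  \sum_(w <- msupp f) << (P0val w).1 i * f@_w *g w >>.

Definition ydy p (f : CP0) : CP0 :=
  \sum_(w <- msupp f) << (P0val w).2 p * f@_w *g w >>.

Definition principal_ideal (d : CP0) : set CP0 := [set h * d | h in setT]%classic.

Definition supersymmetric (f : ZP0) : Prop := forall i p,
  principal_ideal (yvar C p - xvar C i) (ydy p (toCP0 f) + xdx i (toCP0 f)).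

Definition Jg : set ZP0 :=
  [set f | W0_invariant f /\ supersymmetric f]%classic.

(* J(g)_{0,0}; the ideals are those of C[P_0], as for J(g) *)
Definition Jg00 : set ZP0 :=
  [set f | [/\ Laurent f, W0_invariant f & supersymmetric f]]%classic.

(* x_i / y_p is e^(eps_i - delta_p) *)
Definition odd_product : ZP0 :=
  \prod_(i < n) \prod_(p < m) (1 - expw int (eps i - del p)).

(* J(g)_{a,b}, computed from representatives a, b of classes in C/Z *)
Definition Jgab (a b : C) : set ZP0 :=
  (if a + b \notin @Cint R then
     [set xpow int a * ypow int b * odd_product * h
        | h in [set h | Laurent h /\ W0_invariant h]]
   else if a \notin @Cint R then
     [set xpow int a * ypow int (- a) * h | h in Jg00]
   else Jg00)%classic.

End Weights.

Arguments Jg : clear implicits.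
Arguments Jgab {R} n m a b.

(* Main.v *)
From HB Require Import structures.
Require Import Defs.
From mathcomp Require Import all_fingroup.
From mathcomp Require Import all_boot all_order all_algebra.
From mathcomp Require Import finmap boolp classical_sets reals complex.
From mathcomp.multinomials Require Import monalg.

Set Implicit Arguments.
Unset Strict Implicit.
Unset Printing Implicit Defensive.

Import GRing.Theory Num.Theory.
Local Open Scope ring_scope.
Local Open Scope quotient_scope.

(* An element of C[P_0] is divisible by 1 - x_i / y_p exactly when its
   coefficients sum to zero over every coset of Z v, v = eps_i - delta_p.  The
   operator y_p d/dy_p + x_i d/dx_i is the scalar lambda_i + mu_p on such a
   coset, so supersymmetry of f means that each coset with
   lambda_i + mu_p <> 0 has coefficient sum zero.  This condition is compatible
   with the grading of Z[P_0] by (C/Z)^2 given by the classes of lambda_i and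
   mu_p, so J(g) is the direct sum of its homogeneous components.  In degree
   (a, b) with a + b not an integer all scalars are nonzero, hence f is divisible
   by every 1 - x_i / y_p; since the roots eps_i - delta_p are pairwise
   independent, each factor remains regular modulo the others and f is divisible
   by the product.  If a + b is an integer, multiplication by
   (x_1 ... x_n)^a (y_1 ... y_m)^(-a) preserves all scalars. *)

(* Locked: deciding whether an unlocked [gr_exp w] unifies with [1] amounts to
   comparing the weight [w] with [0], which takes forever on [P0]. *)
HB.lock Definition gr_exp (A : comNzRingType) (G : zmodType) (w : G) :
  group_ring A G := << w >>.
Canonical gr_exp_unlockable := Unlockable gr_exp.unlock.
Arguments gr_exp {A G} w.

(** * Exponentials in a group ring, and regularity of $1-e^v$ *)

Section GroupRingTheory.
Variables (A : comNzRingType) (G : zmodType).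
Local Notation AG := (group_ring A G).
Implicit Types (f g : AG) (u v w : G).

Lemma group_ringP f g : (forall w, f@_w = g@_w) <-> f = g.
Proof. exact: malgP. Qed.

Lemma mcoeff_sumr (I : Type) (s : seq I) (P : pred I) (F : I -> {malg A[G]}) w :
  (\sum_(i <- s | P i) F i)@_w = \sum_(i <- s | P i) (F i)@_w.
Proof. exact: (raddf_sum (mcoeff w)). Qed.

Lemma gr_mcoeffD f g w : (f + g)@_w = f@_w + g@_w.
Proof. exact: (raddfD (mcoeff w)). Qed.

Lemma gr_mcoeffB f g w : (f - g)@_w = f@_w - g@_w.
Proof. exact: (raddfB (mcoeff w)). Qed.

Lemma gr_mulE f g : f * g = gr_mul f g.
Proof. by []. Qed.

Lemma gr_expD u v : gr_exp (u + v) = gr_exp u * gr_exp v :> AG.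
Proof. by rewrite unlock gr_mulE gr_mulUU mulr1. Qed.

Lemma gr_exp0 : gr_exp 0 = 1 :> AG.
Proof. by rewrite unlock. Qed.

Lemma gr_expNK v : gr_exp (- v) * gr_exp v = 1 :> AG.
Proof. by rewrite -gr_expD addNr gr_exp0. Qed.

Lemma gr_expM_cancel v f g : gr_exp v * f * (gr_exp (- v) * g) = f * g.
Proof. by rewrite mulrACA [gr_exp v * _]mulrC gr_expNK mul1r. Qed.

Lemma mcoeff_gr_expM v f w : (gr_exp v * f)@_w = f@_(w - v).
Proof.
rewrite unlock gr_mulE (gr_mulw msuppU_le (fsubset_refl _)).
rewrite big_seq_fset1 mcoeff_sumr [in RHS](monalgE f) mcoeff_sumr; apply: eq_bigr => l _.
rewrite mcoeffUU mul1r !mcoeffU; congr (_ *+ (_ : bool)).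
by rewrite eq_sym addrC -subr_eq eq_sym.
Qed.

(** An element killed by $1-e^v$ has coefficients invariant under translation by $v$. As $v$ has
    infinite order, a nonzero coefficient would recur at infinitely many weights, against finiteness
    of the support. *)
Lemma lreg_sub_gr_exp v : (forall k : nat, v *+ k = 0 -> k = 0%N) ->
  GRing.lreg (1 - gr_exp v : AG).
Proof.
move=> v_free f1 f2 /eqP; rewrite -subr_eq0 -mulrBr => /eqP f0.
apply/eqP; rewrite -subr_eq0; apply/eqP; move: (f1 - f2) f0 => f f0.
have shift w : f@_(w + v) = f@_w.
  have /group_ringP/(_ (w + v)) := f0.
  rewrite mulrBl mul1r gr_mcoeffB mcoeff_gr_expM addrK mcoeff0.
  by move/eqP; rewrite subr_eq0 => /eqP.
have shiftn w k : f@_(w + v *+ k) = f@_w.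
  by elim: k => [|k IHk]; rewrite ?addr0 // mulrSr addrA shift.
apply/group_ringP => w; rewrite mcoeff0; apply/eqP; apply: contraT.
rewrite mcoeff_neq0 => wf.
(* One more translate of [w] than the support has elements. *)
pose s := [seq w + v *+ k | k <- iota 0 (size (msupp f)).+1].
suff : (size s <= size (msupp f))%N by rewrite size_map size_iota ltnn.
apply: uniq_leq_size => [|x /mapP[k _ ->]]; last first.
  by rewrite -mcoeff_neq0 shiftn mcoeff_neq0.
rewrite map_inj_in_uniq ?iota_uniq // => k l _ _ /addrI.
wlog le_kl: k l / (k <= l)%N => [th|].
  by case/orP: (leq_total k l) => le e; [|apply/esym]; exact: th.
move/eqP; rewrite eq_sym -subr_eq0 -mulrnBr // => /eqP/v_free/eqP.
by rewrite subn_eq0 => le_lk; apply/eqP; rewrite eqn_leq le_kl.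
Qed.

Lemma lreg_gr_exp v : GRing.lreg (gr_exp v : AG).
Proof.
apply: can_inj (_ : cancel _ ( *%R (gr_exp (- v)))) => f.
by rewrite mulrA gr_expNK mul1r.
Qed.

(** Geometric sum for $k\ge 0$, built by $1-e^{(n+1)v}=(1-e^v)+e^v(1-e^{nv})$; negative exponents
    reduce to this by $1-e^{-u}=-e^{-u}(1-e^u)$. *)
Lemma sub_gr_exp_dvd v (k : int) :
  exists g : AG, 1 - gr_exp (v *~ k) = (1 - gr_exp v) * g.
Proof.
have nat_case (n : nat) : exists g : AG, 1 - gr_exp (v *+ n) = (1 - gr_exp v) * g.
  elim: n => [|n [g IHn]]; first by exists 0; rewrite mulr0 mulr0n gr_exp0 subrr.
  exists (1 + gr_exp v * g); rewrite mulrDr mulr1 mulrCA -IHn mulrBr mulr1.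
  by rewrite mulrS gr_expD addrA subrK.
case: k => n; first exact: nat_case.
have [g def_g] := nat_case n.+1.
exists (- (gr_exp (- (v *+ n.+1)) * g)).
by rewrite NegzE mulrNz mulrN mulrCA -def_g mulrBr mulr1 gr_expNK opprB.
Qed.

End GroupRingTheory.

(** * Functoriality of the group ring *)

Section PushForward.
Variable A : comNzRingType.

(** Additive in $f$ for any map $h$, multiplicative when $h$ is additive. It is used for the
    projection modulo $\mathbb Z v$, for a section of that projection, and for the Weyl group
    action, since [W0_actr] unfolds to it. *)
Definition push (G H : zmodType) (h : G -> H) (f : group_ring A G) :
    group_ring A H :=
  \sum_(w <- msupp f) << f@_w *g h w >>.

Section Basic.
Variables (G H : zmodType) (h : G -> H).
Implicit Types f g : group_ring A G.

Lemma pushw (d : {fset G}) f : (msupp f `<=` d)%fset ->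
  push h f = \sum_(w <- d) << f@_w *g h w >>.
Proof.
move=> le_d; apply: big_fset_incl => // k _ /mcoeff_outdom ->.
by rewrite monalgU0.
Qed.

Lemma push_is_zmod_morphism : zmod_morphism (push h).
Proof.
move=> f g; rewrite (pushw (msuppB_le f g)).
rewrite (pushw (fsubsetUl _ (msupp g))) (pushw (fsubsetUr (msupp f) _)).
rewrite -sumrB; apply: eq_bigr => w _.
by rewrite (raddfB (mcoeff w)) monalgUB.
Qed.

HB.instance Definition _ := GRing.isZmodMorphism.Build _ _ (push h)
  push_is_zmod_morphism.

Lemma pushU a w : push h << a *g w >> = << a *g h w >>.
Proof. by rewrite (pushw msuppU_le) big_seq_fset1 mcoeffUU. Qed.

Lemma push_exp w : push h (gr_exp w) = gr_exp (h w) :> group_ring A H.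
Proof. by rewrite unlock pushU. Qed.

Lemma mcoeff_push f q : (push h f)@_q = \sum_(w <- msupp f | h w == q) f@_w.
Proof.
rewrite mcoeff_sumr [RHS]big_mkcond; apply: eq_bigr => w _.
by rewrite mcoeffU mulrb.
Qed.

Lemma mcoeff_pushw (d : {fset G}) f q : (msupp f `<=` d)%fset ->
  (push h f)@_q = \sum_(w <- d | h w == q) f@_w.
Proof.
move=> le_d; rewrite (pushw le_d) mcoeff_sumr [RHS]big_mkcond.
by apply: eq_bigr => w _; rewrite mcoeffU mulrb.
Qed.

Lemma mcoeff_push_inj f w : injective h -> (push h f)@_(h w) = f@_w.
Proof.
move=> h_inj; rewrite [in RHS](monalgE f) !mcoeff_sumr; apply: eq_bigr => l _.
by rewrite !mcoeffU (inj_eq h_inj).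
Qed.

End Basic.

Section Multiplicative.
Variables (G H : zmodType) (h : {additive G -> H}).

Lemma push_is_monoid_morphism : monoid_morphism (push h).
Proof.
split=> [|f g]; first by rewrite -gr_exp0 push_exp raddf0 gr_exp0.
rewrite [in LHS](monalgE f) [in LHS](monalgE g) mulr_suml raddf_sum mulr_suml.
apply: eq_bigr => k _; rewrite !mulr_sumr raddf_sum; apply: eq_bigr => l _.
by rewrite /= gr_mulE gr_mulUU pushU raddfD [in RHS]gr_mulE gr_mulUU.
Qed.

HB.instance Definition _ := GRing.isMonoidMorphism.Build _ _ (push h)
  push_is_monoid_morphism.

Lemma pushM f g : push h (f * g) = push h f * push h g.
Proof. exact: rmorphM. Qed.

Lemma push_sub_exp w : push h (1 - gr_exp w) = 1 - gr_exp (h w) :> group_ring A H.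
Proof. by rewrite raddfB /= push_exp rmorph1. Qed.

End Multiplicative.
End PushForward.

(** * The quotient of a group by $\mathbb Z v$ *)

Section LineQuotient.
Variable G : zmodType.

Definition zline (v : G) : {pred G} := fun w => `[< exists k : int, w = v *~ k >].

Lemma zline_zmod_closed v : zmod_closed (zline v).
Proof.
split=> [|x y /asboolP[k ->] /asboolP[l ->]]; apply/asboolP; first by exists 0.
by exists (k - l); rewrite mulrzBr.
Qed.

HB.instance Definition _ v :=
  GRing.isZmodClosed.Build G (zline v) (zline_zmod_closed v).

Definition line_quot v := {ideal_quot (zline v)}.
HB.instance Definition _ v := GRing.Zmodule.on (line_quot v).

Definition line_pi v (w : G) : line_quot v := \pi_({ideal_quot (zline v)}) w.

Lemma line_pi_is_zmod_morphism v : zmod_morphism (line_pi v).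
Proof. by move=> x y; rewrite /line_pi raddfB. Qed.

HB.instance Definition _ v :=
  GRing.isZmodMorphism.Build G (line_quot v) (line_pi v)
    (line_pi_is_zmod_morphism v).

(** Only a set-theoretic section; pushing along it is additive but in general not multiplicative. *)
Definition line_repr v (q : line_quot v) : G :=
  repr (q : {ideal_quot (zline v)}).

Lemma line_reprK v : cancel (@line_repr v) (line_pi v).
Proof. by move=> q; apply: reprK. Qed.

Lemma line_piP v x y :
  line_pi v x = line_pi v y <-> exists k : int, x - y = v *~ k.
Proof.
rewrite /line_pi; split=> [/eqP|/asboolP xy].
  by rewrite -Quotient.idealrBE => /asboolP.
by apply/eqP; rewrite -Quotient.idealrBE.
Qed.

Lemma line_pi0 v : line_pi v v = 0.
Proof.
by rewrite -(raddf0 (line_pi v)); apply/line_piP; exists 1; rewrite subr0.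
Qed.

End LineQuotient.

(** * Divisibility by $1-e^v$ and by products of such factors *)

Section Divisibility.
Variables (A : comNzRingType) (G : zmodType).
Local Notation AG := (group_ring A G).
Implicit Types (f g : AG) (u v w : G).

(* The sum of the coefficients of [f] over the coset [w + Z v]. *)
Definition line_sum v f w : A := (push (line_pi v) f)@_(line_pi v w).

Lemma line_sum0 v w : line_sum v 0 w = 0.
Proof. by rewrite /line_sum raddf0 mcoeff0. Qed.

Lemma line_sumB v f g w : line_sum v (f - g) w = line_sum v f w - line_sum v g w.
Proof. by rewrite /line_sum raddfB /= gr_mcoeffB. Qed.

Lemma line_sum_expM u v f w :
  line_sum v (gr_exp u * f) w = line_sum v f (w - u).
Proof. by rewrite /line_sum pushM push_exp mcoeff_gr_expM /= -raddfB. Qed.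

Lemma line_sum_eq0 v f :
  (forall w, line_sum v f w = 0) <-> push (line_pi v) f = 0.
Proof.
split=> [f0|f0 w]; last by rewrite /line_sum f0 mcoeff0.
by apply/group_ringP => q; rewrite -[q]line_reprK mcoeff0; apply: f0.
Qed.

Lemma gr_scaleE a w : (<< a *g w >> : AG) = (<< a *g 0 >> : AG) * gr_exp w.
Proof. by rewrite unlock gr_mulE gr_mulUU mulr1 add0r. Qed.

(* Lifting the image of [f] along a section of [line_pi v] replaces each [e^w]
   by an [e^w'] congruent to it modulo [1 - e^v]. *)
Lemma push_line_pi_eq0 v f :
  push (line_pi v) f = 0 <-> exists g, f = (1 - gr_exp v) * g.
Proof.
split=> [f0|[g ->]]; last first.
  by rewrite pushM push_sub_exp /= line_pi0 gr_exp0 subrr mul0r.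
suff [g def_g] : exists g, f - push (@line_repr _ v) (push (line_pi v) f) =
    (1 - gr_exp v) * g.
  by exists g; rewrite -def_g f0 raddf0 subr0.
have -> : push (@line_repr _ v) (push (line_pi v) f) =
    \sum_(w <- msupp f) << f@_w *g line_repr (line_pi v w) >>.
  rewrite [push (line_pi v) f]/push raddf_sum; apply: eq_bigr => w _ /=.
  by rewrite pushU.
rewrite [X in X - _](monalgE f : f = _ :> AG) -sumrB.
apply: (big_ind (fun h : AG => exists g, h = (1 - gr_exp v) * g)).
- by exists 0; rewrite mulr0.
- by move=> _ _ [g1 ->] [g2 ->]; exists (g1 + g2); rewrite mulrDr.
move=> w _; set w' := line_repr _.
have /line_piP[k def_k] : line_pi v w' = line_pi v w by rewrite line_reprK.
have [g def_g] := sub_gr_exp_dvd A v k.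
exists ((<< f@_w *g 0 >> : AG) * gr_exp w * g).
rewrite mulrCA -def_g mulrBr mulr1 [in LHS]gr_scaleE.
congr (_ - _); rewrite -mulrA -gr_expD -def_k addrC subrK.
exact: gr_scaleE.
Qed.

(** The unit $e^u$ does not affect divisibility; it is included because
    $y_p-x_i=e^{\delta_p}(1-e^{\varepsilon_i-\delta_p})$. *)
Lemma dvd_exp_sub_gr_exp v u f :
  (exists h, h * (gr_exp u * (1 - gr_exp v)) = f) <->
  forall w, line_sum v f w = 0.
Proof.
rewrite line_sum_eq0; split=> [[h <-]|/push_line_pi_eq0[g ->]].
  by apply/push_line_pi_eq0; exists (h * gr_exp u); rewrite mulrA [LHS]mulrC.
exists (g * gr_exp (- u)).
by rewrite mulrA -(mulrA g) gr_expNK mulr1 [LHS]mulrC.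
Qed.

Lemma lreg_prod_sub_gr_exp (I : Type) (s : seq I) (v : I -> G) :
  (forall i (k : nat), v i *+ k = 0 -> k = 0%N) ->
  GRing.lreg (\prod_(i <- s) (1 - gr_exp (v i)) : AG).
Proof.
move=> v_free; elim/big_rec: _ => [|i x _ x_reg]; first exact: lreg1.
by apply: lregM x_reg; apply: lreg_sub_gr_exp => k /v_free.
Qed.

(** Induction on [s]: after dividing $f$ by the first factor, the quotient still has zero image
    modulo each remaining $v_j$, because the factor removed stays regular there. *)
Lemma dvd_prod_sub_gr_exp (I : eqType) (s : seq I) (v : I -> G) f :
  uniq s ->
  (forall i j, i \in s -> j \in s -> i != j ->
    forall (k : nat) (l : int), v i *+ k = v j *~ l -> k = 0%N) ->
  (forall i w, i \in s -> line_sum (v i) f w = 0) ->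
  exists g, f = (\prod_(i <- s) (1 - gr_exp (v i))) * g.
Proof.
move=> uniq_s indep f0; have {f0}: forall i, i \in s -> push (line_pi (v i)) f = 0.
  by move=> i si; apply/line_sum_eq0 => w; apply: f0.
elim: s f uniq_s indep => [|i s IHs] f /=; first by exists f; rewrite big_nil mul1r.
case/andP=> i_s uniq_s indep f0.
have [g def_f] := (push_line_pi_eq0 _ _).1 (f0 i (mem_head _ _)).
have [||j js|h def_g] := IHs g => //.
- by move=> j l js ls; apply: indep; rewrite inE ?js ?ls orbT.
- have ij : i != j by apply: contraNneq i_s => ->.
  have := f0 j; rewrite inE js orbT => /(_ isT).
  rewrite def_f pushM push_sub_exp /= => gj0.
  (* Independence says that the class of $v_i$ modulo $\mathbb Z v_j$ has infinite order, so
     $1-e^{v_i}$ maps to a regular element. *)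
  apply: (@lreg_sub_gr_exp _ _ (line_pi (v j) (v i))).
    move=> k; rewrite -raddfMn -(raddf0 (line_pi (v j))) => /line_piP[l].
    rewrite subr0; apply: indep => //; first exact: mem_head.
    by rewrite inE js orbT.
  by rewrite mulr0.
by exists h; rewrite big_cons def_f def_g mulrA.
Qed.

Lemma mcoeff_grM f g w :
  (f * g)@_w = \sum_(v <- msupp f) f@_v * g@_(w - v).
Proof.
rewrite [in LHS](monalgE f) mulr_suml mcoeff_sumr; apply: eq_bigr => v _.
rewrite gr_mulE (gr_mulw msuppU_le (fsubset_refl _)) big_seq_fset1 mcoeff_sumr.
rewrite [in RHS](monalgE g) mcoeff_sumr mulr_sumr; apply: eq_bigr => l _.
rewrite mcoeffUU !mcoeffU mulrnAr; congr (_ *+ (_ : bool)).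
by rewrite eq_sym addrC -subr_eq eq_sym.
Qed.

(** Common formula for all operators that change coefficients weight by weight; $\phi_u(0)=0$ makes
    it valid off the support as well. *)
Lemma mcoeff_map_diag (B : comNzRingType) (phi : G -> A -> B) f w :
  (forall u, phi u 0 = 0) ->
  (\sum_(u <- msupp f) << phi u f@_u *g u >> : {malg B[G]})@_w = phi w f@_w.
Proof.
move=> phi0; rewrite mcoeff_sumr.
have [wf|wf] := boolP (w \in msupp f).
  rewrite (big_fsetD1 w) //= mcoeffUU big1_fset ?addr0 // => u.
  by rewrite in_fsetD1 mcoeffU; case: eqP.
rewrite (mcoeff_outdom wf) phi0 big1_fset // => u uf _.
by rewrite mcoeffU; case: eqP wf => // <-; rewrite uf.
Qed.

End Divisibility.

(** * Operators acting by a scalar on each weight *)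

Section DiagonalOperators.
Variables (G : zmodType) (B : comNzRingType).

(** [toCP0] is an instance of this, and [xdx i], [ydy p] are instances of [diag_op] with $c$ a
    coordinate of the weight. *)
Definition map_intr (f : group_ring int G) : group_ring B G :=
  \sum_(w <- msupp f) << (f@_w)%:~R *g w >>.

Definition diag_op (c : G -> B) (f : group_ring B G) : group_ring B G :=
  \sum_(w <- msupp f) << c w * f@_w *g w >>.

Lemma mcoeff_map_intr f w : (map_intr f)@_w = (f@_w)%:~R.
Proof. exact: (@mcoeff_map_diag _ _ _ (fun=> intr)). Qed.

Lemma mcoeff_diag_op c f w : (diag_op c f)@_w = c w * f@_w.
Proof.
by apply: (@mcoeff_map_diag _ _ _ (fun u => *%R (c u))) => u; rewrite mulr0.
Qed.

(** Since $c_1+c_2$ is constant on each coset of $\mathbb Z v$, it factors out of the coset sum. The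
    first hypothesis then splits the vanishing of the product. *)
Lemma line_sum_diag_op_eq0 v c1 c2 f :
  (forall (x : B) (k : int), x * k%:~R = 0 -> x = 0 \/ k = 0) ->
  (forall w u (k : int), u - w = v *~ k -> c1 u + c2 u = c1 w + c2 w) ->
  (forall w,
    line_sum v (diag_op c1 (map_intr f) + diag_op c2 (map_intr f)) w = 0) <->
  forall w, c1 w + c2 w = 0 \/ line_sum v f w = 0.
Proof.
move=> domB c_coset; set F := _ + _.
have F_coef w : F@_w = (c1 w + c2 w) * (f@_w)%:~R.
  by rewrite gr_mcoeffD !mcoeff_diag_op !mcoeff_map_intr mulrDl.
(* The scalars may kill weights of $f$, so both coset sums are taken over the support of $f$. *)
have le_F : (msupp F `<=` msupp f)%fset.
  apply/fsubsetP => w; rewrite -!mcoeff_neq0 F_coef; apply: contra_neq => ->.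
  by rewrite mulr0.
have sum_coef w : line_sum v F w = (c1 w + c2 w) * (line_sum v f w)%:~R.
  rewrite /line_sum (mcoeff_pushw _ _ le_F) mcoeff_push rmorph_sum mulr_sumr.
  apply: eq_bigr => u /eqP/line_piP[k def_k]; rewrite F_coef.
  by rewrite (c_coset _ _ _ def_k).
split=> [F0 w|H w]; first by apply: domB; rewrite -sum_coef F0.
by rewrite sum_coef; case: (H w) => ->; rewrite ?mul0r ?mulr0.
Qed.

End DiagonalOperators.

(** * Classes in $\mathbb C/\mathbb Z$ *)

Section CmodZTheory.
Variable R : realType.
Local Notation pi := (\pi_(CmodZ R)).

Lemma CmodZ_eqP (a b : R[i]) : pi a = pi b <-> a - b \in @Cint R.
Proof.
split=> [/eqP|ab]; first by rewrite -Quotient.idealrBE.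
by apply/eqP; rewrite -Quotient.idealrBE.
Qed.

Lemma CmodZ_pi_is_zmod_morphism : zmod_morphism (\pi_(CmodZ R)).
Proof. exact: (raddfB (\pi_({ideal_quot (@Cint R)}))). Qed.

Lemma CmodZ_pi_eq0 (a : R[i]) : pi a = 0 <-> a \in @Cint R.
Proof.
have <- : pi 0 = 0 by rewrite -(subrr 0) CmodZ_pi_is_zmod_morphism subrr.
by rewrite -{2}(subr0 a); apply: CmodZ_eqP.
Qed.

End CmodZTheory.

(** * Odd roots and the supersymmetry condition *)

Section Supersymmetry.
Variables (R : realType) (n m : nat).
Local Notation P0 := (P0 R n m).
Local Notation ZP0 := (group_ring int P0).
Local Notation CP0 := (group_ring R[i] P0).
Implicit Types (f g : ZP0) (u v w : P0).

Definition oddroot (i : 'I_n) (p : 'I_m) : P0 := eps R m i - del R n p.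

Lemma P0_eqP u v :
  (forall i, (P0val u).1 i = (P0val v).1 i) ->
  (forall p, (P0val u).2 p = (P0val v).2 p) -> u = v.
Proof.
move=> uv1 uv2; apply: val_inj; rewrite /=.
by apply: injective_projections; apply/ffunP.
Qed.

Lemma P0val_is_zmod_morphism : zmod_morphism (@P0val R n m).
Proof. exact: (raddfB val). Qed.
HB.instance Definition _ := GRing.isZmodMorphism.Build _ _ (@P0val R n m)
  P0val_is_zmod_morphism.

Lemma weight1B u v i : (P0val (u - v)).1 i = (P0val u).1 i - (P0val v).1 i.
Proof. by rewrite raddfB /= !ffunE. Qed.

Lemma weight2B u v p : (P0val (u - v)).2 p = (P0val u).2 p - (P0val v).2 p.
Proof. by rewrite raddfB /= !ffunE. Qed.

Lemma weight1Mz u (k : int) i : (P0val (u *~ k)).1 i = (P0val u).1 i *~ k.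
Proof.
have nat_case l : (P0val (u *+ l)).1 i = (P0val u).1 i *+ l.
  rewrite raddfMn; elim: l => [|l IHl]; first by rewrite ?mulr0n /= ?ffunE.
  by rewrite !mulrS /= ffunE IHl.
case: k => l; first exact: nat_case.
by rewrite NegzE !mulrNz raddfN /= ffunE nat_case.
Qed.

Lemma weight2Mz u (k : int) p : (P0val (u *~ k)).2 p = (P0val u).2 p *~ k.
Proof.
have nat_case l : (P0val (u *+ l)).2 p = (P0val u).2 p *+ l.
  rewrite raddfMn; elim: l => [|l IHl]; first by rewrite ?mulr0n /= ?ffunE.
  by rewrite !mulrS /= ffunE IHl.
case: k => l; first exact: nat_case.
by rewrite NegzE !mulrNz raddfN /= ffunE nat_case.
Qed.

Lemma weight1_oddroot i p j : (P0val (oddroot i p)).1 j = (j == i)%:R.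
Proof. by rewrite weight1B !ffunE subr0. Qed.

Lemma weight2_oddroot i p q : (P0val (oddroot i p)).2 q = - (q == p)%:R.
Proof. by rewrite weight2B !ffunE sub0r. Qed.

Lemma principal_idealP i p (F : CP0) :
  principal_ideal (yvar R n R[i] p - xvar R m R[i] i) F <->
  forall w, line_sum (oddroot i p) F w = 0.
Proof.
have -> : yvar R n R[i] p - xvar R m R[i] i =
    gr_exp (del R n p) * (1 - gr_exp (oddroot i p)).
  rewrite mulrBr mulr1 -gr_expD /oddroot [del R n p + _]addrC subrK.
  by rewrite unlock.
by rewrite -(dvd_exp_sub_gr_exp _ (del R n p)); split=> [[h _]|[h]]; exists h.
Qed.

(* The operator [y_p d/dy_p + x_i d/dx_i] acts as a scalar on each coset of
   [Z (eps_i - del_p)]. *)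
Lemma supersymmetricP f :
  supersymmetric f <-> forall i p w, (P0val w).1 i + (P0val w).2 p = 0 \/
    line_sum (oddroot i p) f w = 0.
Proof.
suff susy_ip i p :
    (forall w, line_sum (oddroot i p) (ydy p (toCP0 f) + xdx i (toCP0 f)) w = 0) <->
    forall w, (P0val w).1 i + (P0val w).2 p = 0 \/ line_sum (oddroot i p) f w = 0.
  split=> H i p; first exact/susy_ip/principal_idealP/H.
  exact/principal_idealP/susy_ip/H.
rewrite addrC.
apply: (@line_sum_diag_op_eq0 _ _ _
  (fun w => (P0val w).1 i) (fun w => (P0val w).2 p)).
  by move=> x k /eqP; rewrite mulf_eq0 intr_eq0 => /orP[]/eqP; [left|right].
move=> w u k def_k.
(* Adding $k(\varepsilon_i-\delta_p)$ raises $\lambda_i$ by $k$ and lowers $\mu_p$ by $k$. *)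
have := weight1Mz (oddroot i p) k i; have := weight2Mz (oddroot i p) k p.
rewrite -def_k weight1B weight2B weight1_oddroot weight2_oddroot !eqxx mulNrz.
move=> /(canRL (subrK _)) -> /(canRL (subrK _)) ->.
by rewrite addrACA addrN add0r.
Qed.

Lemma supersymmetric_line_sum0 f :
  (forall i p w, line_sum (oddroot i p) f w = 0) -> supersymmetric f.
Proof. by move=> f0; apply/supersymmetricP => i p w; right; apply: f0. Qed.

Lemma supersymmetricB f g :
  supersymmetric f -> supersymmetric g -> supersymmetric (f - g).
Proof.
move=> /supersymmetricP f_ss /supersymmetricP g_ss.
apply/supersymmetricP => i p w.
have [->|fw] := f_ss i p w; first by left.
have [->|gw] := g_ss i p w; first by left.
by right; rewrite line_sumB fw gw subrr.
Qed.

(** The shift adds $c$ to every $\lambda_i$ and $-c$ to every $\mu_p$, so all scalars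
    $\lambda_i+\mu_p$ are preserved. *)
Lemma supersymmetric_shift (c : R[i]) f : supersymmetric f ->
  supersymmetric (gr_exp (diag_weight n m c (- c)) * f).
Proof.
move=> /supersymmetricP f_ss; apply/supersymmetricP => i p w.
have [c0|f0] := f_ss i p (w - diag_weight n m c (- c)); [left|right].
  by move: c0; rewrite weight1B weight2B !ffunE opprK addrACA addNr addr0.
by rewrite line_sum_expM.
Qed.

Lemma expwE (A : comNzRingType) w : expw A w = gr_exp w.
Proof. by rewrite unlock. Qed.

Lemma odd_productE : odd_product R n m =
  \prod_(ip <- enum predT) (1 - gr_exp (oddroot ip.1 ip.2)).
Proof.
rewrite big_enum /= -(pair_bigA _ (fun i p => 1 - gr_exp (oddroot i p))) /=.
by apply: eq_bigr => i _; apply: eq_bigr => p _; rewrite expwE.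
Qed.

(** Compare coordinates at [i] and [p]: on the right one of them vanishes, because the index pairs
    differ, while on the left they are $k$ and $-k$. *)
Lemma oddroot_indep (ip jq : 'I_n * 'I_m) (k : nat) (l : int) : ip != jq ->
  oddroot ip.1 ip.2 *+ k = oddroot jq.1 jq.2 *~ l -> k = 0%N.
Proof.
case: ip jq => i p [j q] /= ne_ij kl; apply/eqP.
have kl1 : (k%:R : R[i]) = (i == j)%:R *~ l.
  have := congr1 (fun w : P0 => (P0val w).1 i) kl.
  by rewrite (weight1Mz _ k%:Z) weight1Mz !weight1_oddroot eqxx.
have kl2 : (k%:R : R[i]) = (p == q)%:R *~ l.
  apply: oppr_inj; have := congr1 (fun w : P0 => (P0val w).2 p) kl.
  by rewrite (weight2Mz _ k%:Z) weight2Mz !weight2_oddroot eqxx !mulNrz.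
rewrite -(pnatr_eq0 R[i]); case: (eqVneq i j) kl1 => [ij _|_ ->];
  last by rewrite mul0rz.
move: ne_ij; rewrite xpair_eqE ij eqxx /= => /negPf pq.
by rewrite kl2 pq mul0rz.
Qed.

Lemma line_sum_odd_productM i p f w :
  line_sum (oddroot i p) (odd_product R n m * f) w = 0.
Proof.
move: w; apply/line_sum_eq0/push_line_pi_eq0.
rewrite odd_productE big_enum (bigD1 (i, p)) //=.
by eexists; rewrite -mulrA.
Qed.

Lemma odd_product_dvd f :
  (forall i p w, line_sum (oddroot i p) f w = 0) ->
  exists g, f = odd_product R n m * g.
Proof.
move=> f0; rewrite odd_productE; apply: dvd_prod_sub_gr_exp.
- exact: enum_uniq.
- by move=> ip jq _ _ /oddroot_indep.
by move=> ip w _; apply: f0.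
Qed.

Lemma lreg_odd_product : GRing.lreg (odd_product R n m).
Proof.
rewrite odd_productE; apply: lreg_prod_sub_gr_exp => ip k k0.
have := congr1 (fun w : P0 => (P0val w).1 ip.1) k0.
rewrite (weight1Mz _ k%:Z) weight1_oddroot eqxx /= ffunE => /eqP.
by rewrite pnatr_eq0 => /eqP.
Qed.

End Supersymmetry.

(** * Elements fixed by an induced map *)

Section FixedElements.
Variables (A : comNzRingType) (G : zmodType).
Implicit Types f g : group_ring A G.

Lemma push_fixP (h h' : G -> G) f : cancel h h' -> cancel h' h ->
  push h f = f <-> forall w, f@_(h w) = f@_w.
Proof.
move=> hK h'K; have h_inj := can_inj hK; split=> [ff w|fh].
  by rewrite -{1}ff mcoeff_push_inj.
by apply/group_ringP => w; rewrite -[w]h'K mcoeff_push_inj ?fh.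
Qed.

Lemma push_fixM (h : {additive G -> G}) f g :
  push h f = f -> push h g = g -> push h (f * g) = f * g.
Proof. by rewrite pushM => -> ->. Qed.

Lemma push_fix_cancel (h : {additive G -> G}) f g : GRing.lreg f ->
  push h f = f -> push h (f * g) = f * g -> push h g = g.
Proof. by rewrite pushM => f_reg -> /f_reg. Qed.

Lemma push_prod_sub_gr_exp (h : {additive G -> G}) (I : Type) (s : seq I)
    (v : I -> G) :
  push h (\prod_(i <- s) (1 - gr_exp (v i)) : group_ring A G) =
  \prod_(i <- s) (1 - gr_exp (h (v i))).
Proof. by rewrite rmorph_prod; apply: eq_bigr => i _; rewrite /= push_sub_exp. Qed.

End FixedElements.

(** * Gradings of a group ring by a homomorphism on weights *)

Section Grading.
Variables (A : comNzRingType) (G D : zmodType) (deg : {additive G -> D}).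
Local Notation AG := (group_ring A G).
Implicit Types (f g : AG) (d : D).

Definition homog d f := forall w, f@_w != 0 -> deg w = d.

Definition gr_proj d f : AG :=
  \sum_(w <- msupp f) << (if deg w == d then f@_w else 0) *g w >>.

Lemma mcoeff_gr_proj d f w :
  (gr_proj d f)@_w = if deg w == d then f@_w else 0.
Proof.
apply: (@mcoeff_map_diag _ _ _ (fun u x => if deg u == d then x else 0)) => u.
exact: if_same.
Qed.

Lemma gr_proj_is_zmod_morphism d : zmod_morphism (gr_proj d).
Proof.
move=> f g; apply/group_ringP => w; rewrite gr_mcoeffB !mcoeff_gr_proj.
by case: ifP; rewrite ?gr_mcoeffB ?subrr.
Qed.

HB.instance Definition _ d := GRing.isZmodMorphism.Build _ _ (gr_proj d)
  (gr_proj_is_zmod_morphism d).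

Lemma homog_gr_proj d f : homog d (gr_proj d f).
Proof.
by move=> w; rewrite mcoeff_gr_proj; case: (deg w =P d) => [//|_]; rewrite eqxx.
Qed.

Lemma gr_proj_homog d e f : homog e f -> gr_proj d f = if d == e then f else 0.
Proof.
move=> f_e; apply/group_ringP => w; rewrite mcoeff_gr_proj.
have [fw0|/f_e ->] := eqVneq (f@_w) 0.
  by rewrite fw0 if_same; case: ifP => _; rewrite ?fw0 ?mcoeff0.
by rewrite eq_sym; case: ifP => _; rewrite ?mcoeff0.
Qed.

Lemma homog0 d : homog d 0.
Proof. by move=> w; rewrite mcoeff0 eqxx. Qed.

Lemma homogB d f g : homog d f -> homog d g -> homog d (f - g).
Proof.
move=> fd gd w; rewrite gr_mcoeffB.
have [f0|/fd //] := eqVneq (f@_w) 0; have [g0|/gd //] := eqVneq (g@_w) 0.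
by rewrite f0 g0 subrr eqxx.
Qed.

Lemma homog_exp w : homog (deg w) (gr_exp w).
Proof.
move=> u; rewrite unlock mcoeffU; case: (w =P u) => [->//|_].
by rewrite mulr0n eqxx.
Qed.

Lemma homogM d e f g : homog d f -> homog e g -> homog (d + e) (f * g).
Proof.
move=> fd ge w; rewrite mcoeff_grM => /eqP fg_w; apply/eqP; apply: contraT => ne_w.
case: fg_w; rewrite big1_seq // => v /andP[_]; rewrite -mcoeff_neq0 => /fd def_d.
have [->|/ge] := eqVneq (g@_(w - v)) 0; first by rewrite mulr0.
rewrite raddfB /= def_d => def_e.
by rewrite -def_e addrC subrK eqxx in ne_w.
Qed.

Lemma homog_sub_exp w : deg w = 0 -> homog 0 (1 - gr_exp w).
Proof.
move=> w0; apply: homogB; last by rewrite -w0; apply: homog_exp.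
by rewrite -gr_exp0 -(raddf0 deg); apply: homog_exp.
Qed.

Lemma homog_prod_sub_exp (I : Type) (s : seq I) (v : I -> G) :
  (forall i, deg (v i) = 0) -> homog 0 (\prod_(i <- s) (1 - gr_exp (v i))).
Proof.
move=> v0; elim/big_rec: _ => [|i f _ f0].
  by rewrite -gr_exp0 -(raddf0 deg); apply: homog_exp.
by rewrite -[0]addr0; apply: homogM f0; apply: homog_sub_exp.
Qed.

(** Multiplication by an element of degree $0$ preserves degrees. This later allows a cofactor to be
    replaced by its homogeneous component. *)
Lemma gr_projMl d f g : homog 0 f -> gr_proj d (f * g) = f * gr_proj d g.
Proof.
move=> f0; apply/group_ringP => w.
rewrite mcoeff_gr_proj !mcoeff_grM.
transitivity (\sum_(v <- msupp f) if deg w == d then f@_v * g@_(w - v) else 0).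
  by case: ifP => _ //; rewrite big1.
apply: eq_big_seq => v; rewrite -mcoeff_neq0 => /f0 v0.
by rewrite mcoeff_gr_proj raddfB /= v0 subr0; case: ifP => _; rewrite ?mulr0.
Qed.

(** When $v$ has degree $0$, each coset of $\mathbb Z v$ lies in a single degree, so the projection
    keeps or discards it as a whole. *)
Lemma line_sum_gr_proj v d f w : deg v = 0 ->
  line_sum v (gr_proj d f) w = if deg w == d then line_sum v f w else 0.
Proof.
move=> v0; rewrite /line_sum.
have le_p : (msupp (gr_proj d f) `<=` msupp f)%fset.
  apply/fsubsetP => u; rewrite -!mcoeff_neq0 mcoeff_gr_proj.
  by case: ifP; rewrite ?eqxx.
rewrite (mcoeff_pushw _ _ le_p) mcoeff_push.
transitivity (\sum_(u <- msupp f | line_pi v u == line_pi v w)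
    if deg w == d then f@_u else 0); last by case: ifP => _ //; rewrite big1.
apply: eq_bigr => u /eqP/line_piP[k def_k]; rewrite mcoeff_gr_proj.
suff -> : deg u = deg w by [].
by apply/eqP; rewrite -subr_eq0 -raddfB def_k raddfMz v0 mul0rz.
Qed.

Lemma line_sum_homog v d f w : deg v = 0 -> homog d f -> deg w <> d ->
  line_sum v f w = 0.
Proof.
move=> v0 fd /eqP/negPf wd; have := line_sum_gr_proj d f w v0.
by rewrite (gr_proj_homog _ fd) eqxx wd.
Qed.

Lemma mcoeff_gr_proj_fix (h : G -> G) d f : (forall w, deg (h w) = deg w) ->
  (forall w, f@_(h w) = f@_w) ->
  forall w, (gr_proj d f)@_(h w) = (gr_proj d f)@_w.
Proof. by move=> dh fh w; rewrite !mcoeff_gr_proj dh fh. Qed.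

Lemma gr_proj_sum (f : AG) (s : seq D) : uniq s ->
  (forall w, f@_w != 0 -> deg w \in s) -> f = \sum_(d <- s) gr_proj d f.
Proof.
move=> uniq_s f_s; apply/group_ringP => w; rewrite mcoeff_sumr.
under eq_bigr do rewrite mcoeff_gr_proj.
have [fw|/f_s ws] := eqVneq (f@_w) 0.
  by rewrite big1 // => d _; rewrite fw if_same.
rewrite (bigD1_seq (deg w)) //= eqxx big1 ?addr0 // => d.
by rewrite eq_sym => /negPf ->.
Qed.

(** Existence: the finitely many degrees in the support give the components, which stay in $J$.
    Uniqueness: projecting any decomposition to degree $d$ returns its term at $d$. *)
Lemma is_direct_sum_homog (J : set AG) :
  J 0 -> (forall f g, J f -> J g -> J (f - g)) ->
  (forall d f, J f -> J (gr_proj d f)) ->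
  is_direct_sum J (fun d => [set f | J f /\ homog d f]%classic).
Proof.
move=> J0 JB Jproj; split=> [d|f Jf].
  split; [by split=> //; apply: homog0|move=> f g [Jf fd] [Jg gd]|by move=> f []].
  by split; [apply: JB|apply: homogB].
pose s := [fset deg w | w in msupp f]%fset.
pose g := [fsfun d in s => gr_proj d f] : {fsfun D -> AG with 0}.
(* Outside [s] the default value $0$ is correct, since no weight of $f$ has such a degree. *)
have gE d : g d = gr_proj d f.
  rewrite fsfunE; case: ifPn => // ds; apply/esym/group_ringP => w.
  rewrite mcoeff_gr_proj mcoeff0; case: eqP => // wd; apply/eqP.
  apply: contraNT ds; rewrite mcoeff_neq0 => wf.
  by apply/imfsetP; exists w.
exists g; split.
  split=> [d|]; first by rewrite gE; split; [apply: Jproj|apply: homog_gr_proj].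
  under eq_bigr do rewrite gE; apply: gr_proj_sum; first exact: fset_uniq.
  move=> w fw; rewrite mem_finsupp gE; apply/eqP => p0; move: fw.
  by have /group_ringP/(_ w) := p0; rewrite mcoeff_gr_proj eqxx mcoeff0 => ->;
    rewrite eqxx.
move=> g' [g'J def_f]; apply/fsfunP => d; rewrite gE def_f raddf_sum /=.
under eq_bigr => e _ do rewrite (gr_proj_homog d (g'J e).2).
have [dg'|dg'] := boolP (d \in finsupp g').
  rewrite (big_fsetD1 d) //= eqxx big1_fset ?addr0 // => e.
  by rewrite in_fsetD1 eq_sym => /andP[/negPf ->].
rewrite (fsfun_dflt dg') big1_fset // => e eg' _.
by case: eqP dg' => // ->; rewrite eg'.
Qed.

End Grading.

(** * Invariance under $S_n\times S_m$ *)

Section WeylGroup.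
Variables (R : realType) (n m : nat).
Local Notation P0 := (P0 R n m).
Local Notation ZP0 := (group_ring int P0).
Implicit Types (f g : ZP0) (u v w : P0) (s : 'S_n) (t : 'S_m).

Lemma W0_act_is_zmod_morphism s t : zmod_morphism (@W0_act R n m s t).
Proof.
move=> u v; apply: P0_eqP => i; first by rewrite weight1B !ffunE.
by rewrite weight2B !ffunE.
Qed.
HB.instance Definition _ s t := GRing.isZmodMorphism.Build _ _ (@W0_act R n m s t)
  (@W0_act_is_zmod_morphism s t).

Lemma W0_actK s t : cancel (@W0_act R n m s t) (W0_act s^-1 t^-1).
Proof.
by move=> w; apply: P0_eqP => i; rewrite !ffunE invgK permK.
Qed.

Lemma W0_actVK s t : cancel (@W0_act R n m s^-1 t^-1) (W0_act s t).
Proof. by move=> w; rewrite -{1}(invgK s) -{1}(invgK t) W0_actK. Qed.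

Lemma W0_invariantP f :
  W0_invariant f <-> forall s t w, f@_(W0_act s t w) = f@_w.
Proof.
by split=> H s t; apply/(push_fixP f (@W0_actK s t) (@W0_actVK s t)); apply: H.
Qed.

Lemma W0_invariant0 : W0_invariant (0 : ZP0).
Proof. by apply/W0_invariantP => s t w; rewrite !mcoeff0. Qed.

Lemma W0_invariantB f g : W0_invariant f -> W0_invariant g -> W0_invariant (f - g).
Proof.
move=> /W0_invariantP finv /W0_invariantP ginv.
by apply/W0_invariantP => s t w; rewrite !gr_mcoeffB finv ginv.
Qed.

Lemma W0_invariantM f g : W0_invariant f -> W0_invariant g -> W0_invariant (f * g).
Proof. by move=> finv ginv s t; apply: push_fixM; [apply: finv|apply: ginv]. Qed.

Lemma W0_invariant_cancel f g : GRing.lreg f ->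
  W0_invariant f -> W0_invariant (f * g) -> W0_invariant g.
Proof.
by move=> f_reg finv fginv s t; apply: (push_fix_cancel f_reg (finv s t) (fginv s t)).
Qed.

Lemma W0_act_oddroot s t i p :
  W0_act s t (oddroot R i p) = oddroot R (s i) (t p).
Proof.
apply: P0_eqP => j; rewrite !ffunE ?weight1_oddroot ?weight2_oddroot.
  by rewrite (canF_eq (permKV s)).
by rewrite (canF_eq (permKV t)).
Qed.

Lemma W0_invariant_exp_diag a b : W0_invariant (gr_exp (diag_weight n m a b) : ZP0).
Proof.
move=> s t; apply: (etrans (push_exp _ _ _)); congr gr_exp.
by apply: P0_eqP => i; rewrite !ffunE.
Qed.

(** The group permutes the odd roots, hence the factors of the product. *)
Lemma W0_invariant_odd_product : W0_invariant (odd_product R n m).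
Proof.
move=> s t; rewrite odd_productE.
apply: (etrans (push_prod_sub_gr_exp _ _ _ _)); rewrite !big_enum /=.
rewrite [RHS](reindex_inj (h := fun ip : 'I_n * 'I_m => (s ip.1, t ip.2))) /=.
  by apply: eq_bigr => ip _; rewrite W0_act_oddroot.
by move=> [i p] [j q] /= [/perm_inj -> /perm_inj ->].
Qed.

End WeylGroup.

(** * The grading of $\mathbb Z[P_0]$ by $(\mathbb C/\mathbb Z)^2$ *)

Section WeightDegree.
Variables (R : realType) (n m : nat) (i0 : 'I_n) (p0 : 'I_m).
Local Notation P0 := (P0 R n m).
Local Notation ZP0 := (group_ring int P0).
Local Notation pi := (\pi_(CmodZ R)).
Implicit Types (f g : ZP0) (u v w : P0).

(** Within a weight of $P_0$ all $\lambda_i$ are congruent modulo $\mathbb Z$, and so are all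
    $\mu_p$; hence the choice of [i0] and [p0] is immaterial. These indices exist because $n,m\ge
    1$. *)
Definition wdeg w : CmodZ R * CmodZ R := (pi ((P0val w).1 i0), pi ((P0val w).2 p0)).

Lemma wdeg_is_zmod_morphism : zmod_morphism wdeg.
Proof.
move=> u v; rewrite /wdeg weight1B weight2B; apply: injective_projections => /=;
exact: CmodZ_pi_is_zmod_morphism.
Qed.
HB.instance Definition _ := GRing.isZmodMorphism.Build _ _ wdeg
  wdeg_is_zmod_morphism.

Lemma pi_weight w i p :
  (pi ((P0val w).1 i), pi ((P0val w).2 p)) = wdeg w.
Proof.
have /inP0P[w1 w2] := P0valP w.
by apply: injective_projections; apply/CmodZ_eqP; [apply: w1|apply: w2].
Qed.

Lemma wdeg_W0_act s t w : wdeg (W0_act s t w) = wdeg w.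
Proof. by rewrite {1}/wdeg !ffunE pi_weight. Qed.

Lemma wdeg_diag a b : wdeg (diag_weight n m a b) = (pi a, pi b).
Proof. by rewrite /wdeg !ffunE. Qed.

Lemma wdeg_oddroot i p : wdeg (oddroot R i p) = 0.
Proof.
rewrite -(pi_weight _ i p) weight1_oddroot weight2_oddroot !eqxx.
by apply: injective_projections; apply/CmodZ_pi_eq0;
  rewrite ?rpredN; apply/asboolP; exists 1.
Qed.

Lemma LaurentP f : Laurent f <-> homog wdeg 0 f.
Proof.
split=> [fL w|f0 w]; rewrite ?mcoeff_neq0.
  move=> /fL[w1 w2].
  by apply: injective_projections; apply/CmodZ_pi_eq0; [apply: w1|apply: w2].
rewrite -mcoeff_neq0 => /f0 w0; split=> [i|p]; apply/CmodZ_pi_eq0.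
  by have /(congr1 fst) := pi_weight w i p0; rewrite w0.
by have /(congr1 snd) := pi_weight w i0 p; rewrite w0.
Qed.

Lemma homog_odd_product : homog wdeg 0 (odd_product R n m).
Proof.
by rewrite odd_productE; apply: homog_prod_sub_exp => ip; apply: wdeg_oddroot.
Qed.

Lemma Jg_sub f g : Jg R n m f -> Jg R n m g -> Jg R n m (f - g).
Proof.
move=> [f_inv f_ss] [g_inv g_ss].
by split; [apply: W0_invariantB|apply: supersymmetricB].
Qed.

(** Both defining conditions respect the grading: $W_0$ preserves degrees, and odd roots have degree
    $0$, so coset sums are kept or replaced by $0$. *)
Lemma Jg_gr_proj d f : Jg R n m f -> Jg R n m (gr_proj wdeg d f).
Proof.
move=> [/W0_invariantP f_inv /supersymmetricP f_ss]; split.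
  apply/W0_invariantP => s t; apply: mcoeff_gr_proj_fix => [w|w].
    exact: wdeg_W0_act.
  exact: f_inv.
apply/supersymmetricP => i p w.
have [f0|f0] := f_ss i p w; [by left|right].
by rewrite line_sum_gr_proj ?f0 ?if_same //; apply: wdeg_oddroot.
Qed.

Lemma Jg_shift (c : R[i]) f : Jg R n m f ->
  Jg R n m (gr_exp (diag_weight n m c (- c)) * f).
Proof.
move=> [f_inv f_ss]; split; last exact: supersymmetric_shift.
by apply: W0_invariantM => //; apply: W0_invariant_exp_diag.
Qed.

Lemma Jg_odd_productM g : W0_invariant g -> Jg R n m (odd_product R n m * g).
Proof.
move=> g_inv; split.
  by apply: W0_invariantM => //; apply: W0_invariant_odd_product.
by apply: supersymmetric_line_sum0 => i p w; apply: line_sum_odd_productM.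
Qed.

Lemma xpowM_ypow (a b : R[i]) :
  xpow n m int a * ypow n m int b = gr_exp (diag_weight n m a b).
Proof.
rewrite /xpow /ypow !expwE -gr_expD; congr gr_exp.
by apply: P0_eqP => i; rewrite /= !ffunE ?addr0 ?add0r.
Qed.

(** In degree $(a,b)$ one has $\lambda_i+\mu_p\equiv a+b\not\equiv 0$, so supersymmetry forces every
    coset sum to vanish; cosets of other degrees contribute $0$ anyway. *)
Lemma homog_odd_product_dvd (a b : R[i]) f : a + b \notin @Cint R ->
  Jg R n m f -> homog wdeg (pi a, pi b) f -> exists g, f = odd_product R n m * g.
Proof.
move=> ab [_ /supersymmetricP f_ss] f_ab; apply: odd_product_dvd => i p w.
have [w0|//] := f_ss i p w.
apply: (line_sum_homog (wdeg_oddroot i p) f_ab) => /eqP.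
rewrite /= -(pi_weight w i p) xpair_eqE => /andP[].
move=> /eqP/CmodZ_eqP wa /eqP/CmodZ_eqP wb.
have := rpredD wa wb; rewrite addrACA w0 add0r -opprD rpredN.
by rewrite (negPf ab).
Qed.

End WeightDegree.

(** * The sets $J(\mathfrak g)_{a,b}$ as homogeneous components *)

Section Components.
Variables (R : realType) (n m : nat) (i0 : 'I_n) (p0 : 'I_m).
Local Notation pi := (\pi_(CmodZ R)).
Local Notation deg := (wdeg i0 p0).

(** The explicit formulas describe exactly the degree $(a,b)$ part of $J(\mathfrak g)$. The right
    side involves only classes, which gives independence of representatives. *)
Lemma JgabE (a b : R[i]) :
  Jgab n m a b = [set f | Jg R n m f /\ homog deg (pi a, pi b) f]%classic.
Proof.
rewrite /Jgab; case: ifPn => [ab|/negPn ab].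
  apply/seteqP; split=> [_ [h [/(LaurentP i0 p0) h0 h_inv] <-]|f [Jf f_ab]].
    rewrite xpowM_ypow -mulrA mulrCA; split.
      by apply/Jg_odd_productM/W0_invariantM => //; apply: W0_invariant_exp_diag.
    rewrite -(wdeg_diag i0 p0) -[X in homog _ X]add0r.
    apply: homogM; first exact: homog_odd_product.
    by rewrite -[X in homog _ X]addr0; apply: homogM => //; apply: homog_exp.
  have [g def_f] := homog_odd_product_dvd ab Jf f_ab.
  pose d := diag_weight n m a b.
  (* The cofactor [g] is not known to be homogeneous: take its component of degree $(a,b)$ and shift
     it to degree $0$. *)
  pose h := gr_exp (- d) * gr_proj deg (pi a, pi b) g.
  have def_f' : f = xpow n m int a * ypow n m int b * odd_product R n m * h.
    rewrite xpowM_ypow /h gr_expM_cancel.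
    rewrite -gr_projMl; last exact: homog_odd_product.
    by rewrite -def_f (gr_proj_homog _ f_ab) eqxx.
  exists h => //; split.
    apply/(LaurentP i0 p0); rewrite /h -(addNr (wdeg i0 p0 d)); apply: homogM.
      by rewrite -raddfN; apply: homog_exp.
    by rewrite /d wdeg_diag; apply: homog_gr_proj.
  (* Invariance of [h] follows by cancelling an invariant regular factor from the invariant [f]. *)
  case: Jf => f_inv _; move: f_inv; rewrite def_f'; apply: W0_invariant_cancel.
    rewrite xpowM_ypow; apply: lregM; last exact: lreg_odd_product.
    exact: lreg_gr_exp.
  rewrite xpowM_ypow; apply: W0_invariantM; last exact: W0_invariant_odd_product.
  exact: W0_invariant_exp_diag.
have def_b : pi b = pi (- a) by apply/CmodZ_eqP; rewrite opprK addrC.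
case: ifPn => [_|/negPn aZ].
  rewrite def_b -(wdeg_diag i0 p0 a (- a)) xpowM_ypow.
  apply/seteqP; split=> [_ [h [/(LaurentP i0 p0) h0 h_inv h_ss] <-]|f [Jf f_ab]].
    split; first exact: Jg_shift.
    by rewrite -[X in homog _ X]addr0; apply: homogM => //; apply: homog_exp.
  (* The inverse shift, written with [- - a] to match [Jg_shift] at $c=-a$. *)
  pose h := gr_exp (diag_weight n m (- a) (- - a)) * f.
  have [h_inv h_ss] : Jg R n m h by apply: Jg_shift.
  have Nd : diag_weight n m (- a) (- - a) = - diag_weight n m a (- a).
    by apply: P0_eqP => i; rewrite raddfN /= !ffunE.
  exists h; last by rewrite /h Nd mulrA [X in X * f]mulrC gr_expNK mul1r.
  split=> //; apply/(LaurentP i0 p0); rewrite /h Nd.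
  rewrite -(addNr (deg (diag_weight n m a (- a)))).
  by apply: homogM => //; rewrite -raddfN; apply: homog_exp.
(* Now $a$ and $a+b$ are integers, hence so is $b$. *)
have -> : (pi a, pi b) = 0.
  apply: injective_projections; apply/CmodZ_pi_eq0 => //=.
  by rewrite -(rpredDl b aZ).
apply/seteqP; split=> [f [/(LaurentP i0 p0) f0 f_inv f_ss] //|f [[f_inv f_ss] f0]].
by split=> //; apply/(LaurentP i0 p0).
Qed.

End Components.

Theorem proposition7p1 (R : realType) (n m : nat) (hn : (1 <= n)%N) (hm : (1 <= m)%N) :
  (* J(g)_{a,b} only depends on the classes of a and b *)
  (forall a a' b b' : R[i],
     \pi_(CmodZ R) a = \pi_(CmodZ R) a' -> \pi_(CmodZ R) b = \pi_(CmodZ R) b' ->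
     Jgab n m a b = Jgab n m a' b') /\
  is_direct_sum (Jg R n m)
    (fun ab : CmodZ R * CmodZ R => Jgab n m (repr ab.1) (repr ab.2)).
Proof.
pose i0 := Ordinal hn; pose p0 := Ordinal hm; split=> [a a' b b' aa' bb'|].
  by rewrite !(JgabE i0 p0) aa' bb'.
(* With representatives chosen by [repr], the family becomes that of the homogeneous components of
   $J(\mathfrak g)$. *)
have -> : (fun ab : CmodZ R * CmodZ R => Jgab n m (repr ab.1) (repr ab.2)) =
    (fun d => [set f | Jg R n m f /\ homog (wdeg i0 p0) d f]%classic).
  by apply/funext => -[a b]; rewrite (JgabE i0 p0) /= !reprK.
apply: is_direct_sum_homog; last by move=> d f; apply: Jg_gr_proj.
  split; first exact: W0_invariant0.
  by apply: supersymmetric_line_sum0 => i p w; apply: line_sum0.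
by move=> f g; apply: Jg_sub.
Qed.
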